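(* Let $p$ be a prime, let $\mathbb{L}$ be a perfect field of characteristic $p$, let $n\ge 1$, $R=\mathbb{L}[x_1,\dots,x_n]$ and $\mathfrak{m}=(x_1,\dots,x_n)$. Let $d_1,\dots,d_n$ be positive integers and let $f=u_1x_1^{d_1}+\cdots+u_nx_n^{d_n}$ with all $u_i\in\mathbb{L}^{\ast}=\mathbb{L}\setminus\{0\}$. Let $L\in\mathbb{N}\cup\{\infty\}$ be the supremum of all $N\in\mathbb{N}$ such that the $e$-th digits of $\frac1{d_1},\dots,\frac1{d_n}$ add without carrying in base $p$ for all $0\le e\le N$. Then \[ \operatorname{fpt}_{\mathfrak m}(f)=\begin{cases}\frac1{d_1}+\cdots+\frac1{d_n} & \text{if } L=\infty,\\[4pt] \left\langle \frac1{d_1}\right\rangle_L+\cdots+\left\langle\frac1{d_n}\right\rangle_L+\frac1{p^L} & \text{if } L<\infty.\end{cases}\]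
   Context: Test ideals: for an ideal $I\subseteq R$ and $e\ge 0$, $I^{[p^e]}$ is the ideal generated by $\{g^{p^e}: g\in I\}$. Let $\mathscr{B}_e$ be the set of monomials not in $\mathfrak{m}^{[p^e]}$; it is a free basis of $R$ over the subring $R^{p^e}=\mathbb{L}[x_1^{p^e},\dots,x_n^{p^e}]$ of $p^e$-th powers. For $g\in R$ write uniquely $g=\sum_{\mu\in\mathscr{B}_e}\Gamma_\mu^e(g)^{p^e}\mu$ with $\Gamma_\mu^e(g)\in R$, and let $(g)^{[1/p^e]}$ be the ideal generated by all $\Gamma_\mu^e(g)$, $\mu\in\mathscr{B}_e$. For real $\lambda\ge 0$, the ideals $(f^{\lceil p^e\lambda\rceil})^{[1/p^e]}$ increase with $e$, and the test ideal is $\tau(\lambda\bullet f)=\bigcup_{e\ge1}(f^{\lceil p^e\lambda\rceil})^{[1/p^e]}$. The $F$-pure threshold of $f$ at $\mathfrak m$ is $\operatorname{fpt}_{\mathfrak m}(f)=\sup\{\lambda\in\mathbb{R}_{\ge0}:\tau(\lambda\bullet f)_{\mathfrak m}=R_{\mathfrak m}\}$. Base $p$ digits: for $\alpha\in(0,1]$, $\alpha^{(d)}\in\{0,\dots,p-1\}$ ($d\ge1$) are the digits of the unique non-terminating base $p$ expansion $\alpha=\sum_{d\ge1}\alpha^{(d)}/p^d$ (i.e. $\alpha^{(d)}$ is not eventually zero in $d$); by convention $\alpha^{(0)}=0$. The $e$-th truncation is $\langle\alpha\rangle_e=\sum_{d=1}^e\alpha^{(d)}/p^d$ (so $\langle\alpha\rangle_0=0$).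 The $e$-th digits of $\lambda_1,\dots,\lambda_n$ add without carrying in base $p$ if $\lambda_1^{(e)}+\cdots+\lambda_n^{(e)}\le p-1$. *)

(* Defs.v *)
(* The multinomials library has to be imported before MathComp-Analysis: in   *)
(* the other order their notations clash.                                     *)
From HB Require Import structures.
From mathcomp Require Import all_boot all_order all_algebra mpoly.
From mathcomp Require Import all_classical all_reals all_analysis.

Set Implicit Arguments.
Unset Strict Implicit.
Unset Printing Implicit Defensive.

Import Order.TTheory GRing.Theory Num.Theory.
Import numFieldNormedType.Exports.

Local Open Scope classical_set_scope.
Local Open Scope ring_scope.

Section Ideals.
Variable A : comNzRingType.

Definition is_ideal (I : set A) : Prop :=
  [/\ I 0, (forall x y, I x -> I y -> I (x + y))
    & (forall a x, I x -> I (a * x))].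

Definition ideal_gen (S : set A) : set A := smallest is_ideal S.

(* For q = p ^ e this is the e-th Frobenius power of I. *)
Definition frobenius_power (I : set A) (q : nat) : set A :=
  ideal_gen [set g ^+ q | g in I].

End Ideals.

(* When P is a prime ideal of the domain A, this is the localized ideal I_P,  *)
(* seen inside the field of fractions of A; I = setT gives the ring A_P.      *)
Definition localized (A : idomainType) (P I : set A) : set {fraction A} :=
  [set FracField.tofrac a / FracField.tofrac s | a in I & s in ~` P].

Section TestIdeals.
Variables (K : fieldType) (n : nat) (p : nat).
Implicit Types (g f : {mpoly K[n]}) (e : nat).

Definition maxideal : set {mpoly K[n]} := ideal_gen (range (fun i : 'I_n => 'X_i)).

(* Monomials are represented by their exponent vectors. *)
Definition Bset e : set 'X_{1..n} :=
  [set mu | ~ frobenius_power maxideal (p ^ e) 'X_[mu]].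

(* Bset e is finite when 0 < p: it consists of the exponent vectors with all  *)
(* entries below p ^ e, so the sum below is an ordinary finite sum.           *)
Definition is_Gamma e g (c : 'X_{1..n} -> {mpoly K[n]}) : Prop :=
  g = \sum_(mu \in Bset e) c mu ^+ (p ^ e) * 'X_[mu].

(* Over a perfect field of characteristic p, is_Gamma e g determines c on     *)
(* Bset e; the values outside Bset e are irrelevant.                          *)
Definition Gamma e g : 'X_{1..n} -> {mpoly K[n]} :=
  xget (fun=> 0) [set c | is_Gamma e g c].

Definition frobenius_root e g : set {mpoly K[n]} :=
  ideal_gen [set Gamma e g mu | mu in Bset e].

Definition test_ideal (R : realType) (lam : R) f : set {mpoly K[n]} :=
  \bigcup_(e in [set e | (1 <= e)%N])
    frobenius_root e (f ^+ `|Num.ceil ((p ^ e)%:R * lam)|%N).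

(* The supremum is taken in the extended reals, so that it is a genuine least *)
(* upper bound for every f.                                                   *)
Definition fpt (R : realType) f : \bar R :=
  ereal_sup [set lam%:E | lam in [set lam : R | 0 <= lam /\
    localized maxideal (test_ideal lam f) = localized maxideal setT]].

End TestIdeals.

Section Digits.
Variables (R : realType) (p : nat).

Definition digit_sum (a : nat -> nat) (e : nat) : R :=
  \sum_(1 <= k < e.+1) (a k)%:R / p%:R ^+ k.

Definition nonterminating_expansion (alpha : R) (a : nat -> nat) : Prop :=
  [/\ a 0%N = 0%N,
      (forall k, (a k < p)%N),
      digit_sum a @ \oo --> alpha
    & (forall N, exists2 k, (N <= k)%N & a k != 0%N)].

(* For 1 < p and 0 < alpha <= 1 there is exactly one such expansion. *)
Definition digit (alpha : R) : nat -> nat :=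
  xget (fun=> 0%N) [set a | nonterminating_expansion alpha a].

Definition truncation (alpha : R) (e : nat) : R := digit_sum (digit alpha) e.

Definition add_without_carrying n (alpha : 'I_n -> R) (e : nat) : Prop :=
  (\sum_(i < n) digit (alpha i) e <= p.-1)%N.

Definition carry_sup n (alpha : 'I_n -> R) : \bar R :=
  ereal_sup [set N%:R%:E | N in
    [set N : nat | forall e, (e <= N)%N -> add_without_carrying alpha e]].

End Digits.

(* Main.v *)
(* Reading off the coefficients of g on the basis B_e at the origin, (g)^[1/p^e] is not contained in m
   exactly when g has a monomial with all exponents below p^e.  For g = f^N the monomials are x^(d k)
   with sum k = N and p not dividing the multinomial coefficient, i.e. with the k_i adding without
   carrying (Legendre).  The constraint k_i d_i < p^e means k_i <= p^e <1/d_i>_e.  Hence the threshold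
   is the supremum of the ratios (sum k) / p^e over such k.  With no carries at all the truncations
   themselves are optimal; if the first carry occurs at level L + 1, then N / p^e < (A + 1) / p^L
   where A = sum p^L <1/d_i>_L, and lowering the digits from level L + 1 on so that they sum to p - 1
   approaches this bound. *)
Require Import Defs.
From HB Require Import structures.
From mathcomp Require Import all_boot all_order all_algebra mpoly.
From mathcomp Require Import all_classical all_reals all_analysis.

Set Implicit Arguments.
Unset Strict Implicit.
Unset Printing Implicit Defensive.

Import Order.TTheory GRing.Theory Num.Theory.
Import numFieldNormedType.Exports.

(** * Base [p] arithmetic in [nat]: sums without carries and the digits of [1/d] *)

(** The two sides differ by the carry out of the lowest [t] digits, so equality for all [t] says
    that no carry occurs. *)
Definition carry_free p n (k : 'I_n -> nat) : Prop :=
  forall t, (\sum_i k i) %/ p ^ t = \sum_i (k i %/ p ^ t).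

(** The new last digits sum to less than [p], so nothing is carried into the old ones. *)
Lemma carry_free_digits p n (k c : 'I_n -> nat) : 0 < p ->
  carry_free p k -> \sum_i c i <= p.-1 ->
  carry_free p (fun i => k i * p + c i).
Proof.
move=> p_gt0 kP c_le; have c_lt : \sum_i c i < p by rewrite -(prednK p_gt0).
case=> [|t]; first by rewrite expn0 divn1; apply: eq_bigr => i _; rewrite divn1.
rewrite expnS divnMA big_split /= -big_distrl /= divnMDl// (divn_small c_lt) addn0.
rewrite kP; apply: eq_bigr => i _; rewrite divnMA divnMDl// (@divn_small (c i)) ?addn0//.
by apply: leq_ltn_trans c_lt; rewrite (bigD1 i) //= leq_addr.
Qed.

Lemma sum_incr n (k : 'I_n -> nat) (j : 'I_n) :
  \sum_i (k i + (i == j)) = (\sum_i k i).+1.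
Proof.
rewrite big_split /= -addn1; congr addn.
by rewrite (bigD1 j)//= eqxx big1 ?addn0// => i /negPf->.
Qed.

(** Append [m] digits, all [p - 1] in entry [j] and [0] elsewhere. Adding [1] to entry [j] then
    rolls over the whole tail. *)
Lemma carry_free_fill p n (k : 'I_n -> nat) (j : 'I_n) m : 0 < p ->
  carry_free p k ->
  exists k' : 'I_n -> nat, [/\ carry_free p k',
    (\sum_i k' i).+1 = p ^ m * (\sum_i k i).+1
    & forall i, k' i + (i == j) = p ^ m * (k i + (i == j))].
Proof.
move=> p_gt0 kP.
suff [k' [k'P k'E]] : exists k' : 'I_n -> nat, carry_free p k' /\
    forall i, k' i + (i == j) = p ^ m * (k i + (i == j)).
  exists k'; split=> //; rewrite -!(sum_incr _ j) big_distrr /=.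
  exact: eq_bigr.
elim: m => [|m [k' [k'P k'E]]]; first by exists k; split=> // i; rewrite mul1n.
exists (fun i => k' i * p + (i == j) * p.-1); split.
  apply: carry_free_digits => //.
  by rewrite (bigD1 j)//= eqxx mul1n big1 ?addn0// => i /negPf->.
move=> i; rewrite expnS -mulnA -k'E mulnDr [p * _]mulnC -addnA; congr addn.
by case: (i == j); rewrite ?muln0// mul1n muln1 addn1 prednK.
Qed.

Lemma bounded_sum_below n (c : 'I_n -> nat) M : M <= \sum_i c i ->
  exists2 b : 'I_n -> nat, forall i, b i <= c i & \sum_i b i = M.
Proof.
elim: M => [_|M IHM ltM]; first by exists (fun=> 0) => //; rewrite big1.
have [b b_le bM] := IHM (ltnW ltM).
have [j ltj] : exists j, b j < c j.
  apply/existsP; apply: contraLR ltM => /existsPn h.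
  by rewrite -leqNgt -bM leq_sum// => i _; rewrite leqNgt.
exists (fun i => b i + (i == j)).
  by move=> i; case: eqP => [->|_]; rewrite ?addn1// addn0.
by rewrite sum_incr bM.
Qed.

(* [digit_quo p d e] is the integer [p ^ e * <1 / d>_e]: the largest [k] with [k / p ^ e < 1 / d]. *)
Definition digit_quo p d e := (p ^ e).-1 %/ d.

Lemma leq_digit_quo p d e k : 0 < p -> 0 < d ->
  (k <= digit_quo p d e) = (k * d < p ^ e).
Proof.
by move=> p_gt0 d_gt0; rewrite leq_divRL// -[in RHS](@prednK (p ^ e)) ?expn_gt0 ?p_gt0.
Qed.

Lemma digit_quo0 p d : digit_quo p d 0 = 0.
Proof. by rewrite /digit_quo div0n. Qed.

(** Floor divisions by [p] and [d] commute, and dropping the last digit [p - 1] of [p ^ e.+1 - 1]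
    leaves [p ^ e - 1]. *)
Lemma digit_quoS p d e : 0 < p -> digit_quo p d e.+1 %/ p = digit_quo p d e.
Proof.
move=> p_gt0; rewrite /digit_quo -divnMA mulnC divnMA; congr (_ %/ _).
have q_gt0 : 0 < p ^ e by rewrite expn_gt0 p_gt0.
have -> : (p ^ e.+1).-1 = (p ^ e).-1 * p + p.-1.
  by rewrite expnS -{1}(prednK q_gt0) mulnS addnC -subn1 -addnBA// subn1 mulnC.
by rewrite divnMDl// divn_small ?addn0 ?prednK.
Qed.

Lemma digit_quo_succ p d e : 0 < p ->
  digit_quo p d e.+1 = digit_quo p d e * p + digit_quo p d e.+1 %% p.
Proof. by move=> p_gt0; rewrite {1}(divn_eq (digit_quo p d e.+1) p) digit_quoS. Qed.

Lemma digit_quo_shift p d e m : 0 < p ->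
  digit_quo p d (e + m) %/ p ^ m = digit_quo p d e.
Proof.
move=> p_gt0; elim: m => [|m IHm]; first by rewrite divn1 addn0.
by rewrite addnS expnS divnMA digit_quoS.
Qed.

(** * The combinatorial condition on [N] and [e] *)

Section Attained.
Variables (p n : nat) (d : 'I_n -> nat).
Hypotheses (p_gt0 : 0 < p) (d_gt0 : forall i, 0 < d i).

(** By [diagonalX_attained], this says that [f ^ N] has a monomial with all exponents below
    [p ^ e]. *)
Definition attained e N : Prop :=
  exists k : 'I_n -> nat, [/\ carry_free p k, \sum_i k i = N
    & forall i, k i * d i < p ^ e].

(** The remainder [digit_quo p (d i) e %% p] is the [e]-th digit of [1 / d i], by [digitE]. *)
Definition digits_carry_free e : Prop :=
  \sum_i (digit_quo p (d i) e %% p) <= p.-1.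

Lemma carry_free_digit_quo l : (forall e, e <= l -> digits_carry_free e) ->
  carry_free p (fun i => digit_quo p (d i) l).
Proof.
elim: l => [|l IHl] free.
  move=> t; rewrite !big1 ?div0n// => i _; first by rewrite digit_quo0 div0n.
  by rewrite digit_quo0.
have -> : (fun i => digit_quo p (d i) l.+1) =
    (fun i => digit_quo p (d i) l * p + digit_quo p (d i) l.+1 %% p).
  by apply: boolp.funext => i; rewrite -digit_quo_succ.
apply: carry_free_digits => //; last exact: free.
by apply: IHl => e le_el; apply: free; rewrite (leq_trans le_el).
Qed.

Lemma attained_digit_quo l : (forall e, e <= l -> digits_carry_free e) ->
  attained l (\sum_i digit_quo p (d i) l).
Proof.
move=> free; exists (fun i => digit_quo p (d i) l); split=> //.
  exact: carry_free_digit_quo.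
by move=> i; rewrite -leq_digit_quo.
Qed.

(** If [l <= e], dropping the last [e - l] digits commutes with the carry-free sum and takes each
    [k i] to at most [digit_quo p (d i) l]. If [e < l], already
    [k i * p ^ (l - e) <= digit_quo p (d i) l]. *)
Lemma attained_bound l e N : attained e N ->
  N * p ^ l <= (\sum_i digit_quo p (d i) l).+1 * p ^ e.
Proof.
case=> k [kP <- k_lt].
have k_le i : k i <= digit_quo p (d i) e by rewrite leq_digit_quo.
have q_gt0 m : 0 < p ^ m by rewrite expn_gt0 p_gt0.
have [le_le|lt_el] := leqP l e.
  rewrite -(subnKC le_le) expnD mulnA [_.+1 * _]mulnC -mulnA [X in X <= _]mulnC.
  rewrite leq_mul2l; apply/orP; right.
  apply: ltnW; rewrite -ltn_divLR// kP ltnS.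
  apply: leq_sum => i _; rewrite -(digit_quo_shift _ _ (e - l))// subnKC//.
  exact: leq_div2r.
rewrite -(subnKC (ltnW lt_el)) expnD mulnCA [X in X <= _]mulnC leq_mul2r.
apply/orP; right; rewrite ltnW// ltnS big_distrl /=; apply: leq_sum => i _.
by rewrite -leq_divRL// digit_quo_shift.
Qed.

(* A carry at level [l.+1] leaves room to fill that digit, and all later ones, with [p.-1]. *)
Lemma attained_after_carry l m :
  (forall e, e <= l -> digits_carry_free e) -> ~ digits_carry_free l.+1 ->
  exists2 N, attained (l.+1 + m) N
    & N.+1 = p ^ m.+1 * (\sum_i digit_quo p (d i) l).+1.
Proof.
move=> free carry; pose D i := digit_quo p (d i) l.+1 %% p.
have ltD : p.-1 < \sum_i D i by rewrite ltnNge; apply/negP.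
(* Lower the digits at level [l.+1] until they sum to [p - 1], the largest total without a carry. *)
have [c c_le cE] := bounded_sum_below (ltnW ltD).
(* Some entry [j] is strictly lowered. There [k j + 1] still respects the bound, which leaves room
   for a tail of digits [p - 1]. *)
have [j ltj] : exists j, c j < D j.
  apply/existsP; apply: contraLR ltD => /existsPn h.
  by rewrite -leqNgt -cE leq_sum// => i _; rewrite leqNgt.
pose k i := digit_quo p (d i) l * p + c i.
have kP : carry_free p k.
  by apply: carry_free_digits; rewrite ?cE//; exact: carry_free_digit_quo.
have [k' [k'P k'E k'i]] := carry_free_fill j m p_gt0 kP.
exists (\sum_i k' i); last first.
  rewrite k'E expnSr -mulnA; congr (_ * _).
  by rewrite big_split /= cE -big_distrl /= -addnS prednK// mulnS mulnC addnC.
exists k'; split=> // i.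
have k_le : k i + (i == j) <= digit_quo p (d i) l.+1.
  rewrite digit_quo_succ// -addnA leq_add2l.
  by case: eqP => [->|_]; rewrite ?addn1// addn0; exact: c_le.
have bound : (k i + (i == j)) * d i < p ^ l.+1 by rewrite -leq_digit_quo.
have q_gt0 : 0 < p ^ m by rewrite expn_gt0 p_gt0.
apply: (@leq_ltn_trans (p ^ m * ((k i + (i == j)) * d i))).
  by rewrite mulnA -k'i leq_mul2r leq_addr orbT.
by rewrite expnD mulnC ltn_pmul2r.
Qed.
End Attained.

(** * Valuations of multinomial coefficients *)

(** The terms with [t > k] vanish. A common range lets several factorials be compared term by
    term. *)
Lemma logn_fact_leq p k N : prime p -> k <= N ->
  logn p k`! = \sum_(1 <= t < N.+1) k %/ p ^ t.
Proof.
move=> p_pr le_kN; rewrite logn_fact// [RHS](@big_cat_nat _ _ _ k.+1)//=.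
rewrite [X in _ + X]big1_seq ?addn0// => t /andP[_]; rewrite mem_index_iota => /andP[lt_kt _].
by rewrite divn_small// (leq_trans lt_kt)// ltnW// ltn_expl// prime_gt1.
Qed.

Lemma logn_prod_fact p n (k : 'I_n -> nat) :
  logn p (\prod_i (k i)`!) = \sum_i logn p (k i)`!.
Proof.
suff [_ ->] : 0 < \prod_i (k i)`! /\ logn p (\prod_i (k i)`!) = \sum_i logn p (k i)`! by [].
apply: (big_rec2 (fun x y => 0 < x /\ logn p x = y)) => [|i y x _ [x0 <-]].
  by rewrite logn1.
by rewrite muln_gt0 fact_gt0 lognM ?fact_gt0.
Qed.

Lemma leq_sum_divn n (k : 'I_n -> nat) q : 0 < q ->
  \sum_i (k i %/ q) <= (\sum_i k i) %/ q.
Proof.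
by move=> q_gt0; rewrite leq_divRL// big_distrl /= leq_sum// => i _; exact: leq_divM.
Qed.

(* Legendre's formula turns the valuation of a multinomial coefficient into a count of carries. *)
Lemma multinomial_carry_free p n (k : 'I_n -> nat) C : prime p ->
  C * \prod_i (k i)`! = (\sum_i k i)`! -> ~~ (p %| C) <-> carry_free p k.
Proof.
move=> p_pr CE; set N := \sum_i k i in CE *.
have p_gt0 := prime_gt0 p_pr; have q_gt0 t : 0 < p ^ t by rewrite expn_gt0 p_gt0.
have prod_gt0 : 0 < \prod_i (k i)`! by rewrite prodn_gt0// => i; exact: fact_gt0.
have C_gt0 : 0 < C by move: (fact_gt0 N); rewrite -CE muln_gt0 => /andP[].
have le_kN i : k i <= N by rewrite /N (bigD1 i)//= leq_addr.
(* So [logn p C] is the total of the gaps in [leq_sum_divn] over the powers of [p]; it vanishes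
   exactly when every gap does. *)
have valE : \sum_(t < N) N %/ p ^ t.+1 = logn p C + \sum_(t < N) \sum_i k i %/ p ^ t.+1.
  have := congr1 (logn p) CE; rewrite lognM// (@logn_fact_leq _ _ N)// logn_prod_fact.
  under eq_bigr do rewrite (@logn_fact_leq _ _ N)//.
  by rewrite exchange_big /= !big_add1 /= !big_mkord => <-.
have le_t t : true -> \sum_i k i %/ p ^ t <= N %/ p ^ t ?= iff (\sum_i k i %/ p ^ t == N %/ p ^ t).
  by move=> _; split=> //; exact: leq_sum_divn.
have [_ eqP_] := @leqif_sum 'I_N xpredT _ _ _ (fun t => le_t t.+1).
have -> : ~~ (p %| C) = (logn p C == 0).
  by rewrite -[p in p %| C]expn1 pfactor_dvdn// lt0n negbK.
have -> : (logn p C == 0) = [forall t : 'I_N, \sum_i k i %/ p ^ t.+1 == N %/ p ^ t.+1].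
  by rewrite -eqP_ valE -{1}[\sum_(t < N) _]add0n eqn_add2r eq_sym.
split=> [/forallP kP [|t]|kP].
- by rewrite divn1; apply: eq_bigr => i _; rewrite divn1.
(* For [t >= N] the power [p ^ t.+1] exceeds [N] and both sides are [0]. *)
- have [lt_tN|le_Nt] := ltnP t N; first by rewrite -(eqP (kP (Ordinal lt_tN))).
  have lt_N : N < p ^ t.+1 by rewrite (leq_ltn_trans le_Nt)// ltnW// ltn_expl// prime_gt1.
  rewrite divn_small// big1// => i _; rewrite divn_small//.
  exact: leq_ltn_trans lt_N.
- by apply/forallP => t; rewrite kP.
Qed.

Local Open Scope classical_set_scope.
Local Open Scope ring_scope.

(** * Ideals, Frobenius roots and localization at the origin *)

Lemma is_ideal_gen (A : comNzRingType) (S : set A) : is_ideal (ideal_gen S).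
Proof.
split=> [I [[]]//|x y Ix Iy J HJ|a x Ix J HJ].
  by case: (HJ) => -[_ JD _] _; apply: JD; [exact: Ix|exact: Iy].
by case: (HJ) => -[_ _ JM] _; apply: JM; exact: Ix.
Qed.

Lemma is_ideal_sum (A : comNzRingType) (I : set A) (T : Type) (r : seq T)
    (F : T -> A) : is_ideal I -> (forall i, I (F i)) -> I (\sum_(i <- r) F i).
Proof. by case=> I0 ID _ IF; elim/big_ind: _. Qed.

Section Monomials.
Variables (K : fieldType) (n : nat).
Implicit Types (g : {mpoly K[n]}) (m : 'X_{1..n}).

(** Every nonconstant monomial is divisible by a variable, so only the constant term matters. *)
Lemma maxidealE : @maxideal K n = [set g | g@_0%MM = 0].
Proof.
apply/seteqP; split.
  apply: smallest_sub.
    split=> [|x y /= x0 y0|a x /= x0]; rewrite /= ?mcoeff0 ?mcoeffD ?x0 ?y0 ?addr0//.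
    by rewrite (rmorphM (mcoeff 0%MM)) /= x0 mulr0.
  by move=> _ [i _ <-] /=; rewrite mcoeffX mnm1_eq0.
move=> g /= g0; rewrite [g]mpolyE.
apply: is_ideal_sum (is_ideal_gen _) _ => m.
have [_ _ gM] := is_ideal_gen (range (fun i : 'I_n => 'X_i : {mpoly K[n]})).
have [->|m_neq0] := eqVneq m 0%MM.
  by rewrite g0 scale0r; case: (is_ideal_gen (range (fun i : 'I_n => 'X_i : {mpoly K[n]}))).
have [i mi] : exists i, m i != 0%N.
  apply/existsP; apply: contraNT m_neq0 => /existsPn m0.
  by apply/eqP/mnmP => i; rewrite mnm0E; move/eqP: (m0 i) => /eqP; rewrite negbK => /eqP.
have -> : m = (m - U_(i) + U_(i))%MM by rewrite submK// lep1mP.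
rewrite mpolyXD -mul_mpolyC mulrA.
by apply: gM; apply: sub_gen_smallest; exists i.
Qed.
End Monomials.

Section Frobenius.
Variables (p : nat) (K : fieldType) (n : nat).
Hypothesis charK : p \in [pchar K].
Implicit Types (g h : {mpoly K[n]}) (m : 'X_{1..n}).

Lemma pnat_mpoly_pexp e : [pchar {mpoly K[n]}].-nat (p ^ e)%N.
Proof.
rewrite pnatX; apply/orP; left.
rewrite (@eq_pnat _ [pchar K]); last exact: pchar_lalg.
by rewrite pnatE ?(pcharf_prime charK).
Qed.

Lemma exprD_sum_pexp e (T : Type) (r : seq T) (F : T -> {mpoly K[n]}) :
  (\sum_(i <- r) F i) ^+ (p ^ e) = \sum_(i <- r) F i ^+ (p ^ e).
Proof.
elim: r => [|i r IHr]; rewrite ?big_nil ?big_cons; last first.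
  by rewrite exprDn_pchar ?IHr// pnat_mpoly_pexp.
by rewrite expr0n expn_eq0 (gtn_eqF (prime_gt0 (pcharf_prime charK))).
Qed.

(** Frobenius is additive, so all exponents in [g ^+ (p ^ e)] are multiples of [p ^ e]; below
    [p ^ e] only [0] is left. *)
Lemma mcoeff_pexp_small e g m : (forall i, m i < p ^ e)%N ->
  (g ^+ (p ^ e))@_m = if m == 0%MM then g@_0%MM ^+ (p ^ e) else 0.
Proof.
move=> m_lt; have [->|m0] := eqVneq m 0%MM.
  exact: (rmorphXn (mcoeff 0%MM)).
rewrite [g]mpolyE exprD_sum_pexp raddf_sum /= big1// => m' _.
rewrite -mul_mpolyC exprMn -rmorphXn /= mul_mpolyC mcoeffZ mpolyXn mcoeffX.
case: eqP => [mE|]; rewrite ?mulr0//; case/eqP: m0; apply/mnmP => i.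
have := m_lt i; rewrite -mE mulmnE mnm0E.
by case: (m' i) => // a; rewrite mulSn -ltn_subRL subnn.
Qed.

Lemma BsetE e : Bset K p e = [set m : 'X_{1..n} | forall i, (m i < p ^ e)%N].
Proof.
have q_gt0 : (0 < p ^ e)%N by rewrite expn_gt0 prime_gt0// (pcharf_prime charK).
apply/seteqP; split => m /=.
  move=> mN i; rewrite ltnNge; apply/negP => le_m; apply: mN.
  have -> : m = (m - U_(i) *+ (p ^ e) + U_(i) *+ (p ^ e))%MM.
    by rewrite submK//; apply/mnm_lepP => j; rewrite mulmnE mnm1E; case: eqP => [<-|_]; rewrite ?mul1n// mul0n.
  have [_ _ gM] := is_ideal_gen [set g ^+ (p ^ e) | g in @maxideal K n].
  rewrite mpolyXD -mpolyXn; apply: gM; apply: sub_gen_smallest.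
  by exists 'X_i => //; rewrite maxidealE /= mcoeffX mnm1_eq0.
move=> m_lt mI.
(* Polynomials with no monomial in the box form an ideal, and it contains [g ^+ (p ^ e)] for every
   [g] without constant term. *)
suff /(_ _ mI m m_lt) : frobenius_power (@maxideal K n) (p ^ e) `<=`
    [set g | forall m, (forall i, m i < p ^ e)%N -> g@_m = 0].
  by rewrite mcoeffX eqxx => /eqP; rewrite oner_eq0.
apply: smallest_sub.
  split=> [m' _|x y x0 y0 m' lt_m'|a x x0 m' lt_m']; first by rewrite mcoeff0.
    by rewrite mcoeffD x0 ?y0 ?addr0.
  rewrite mcoeffM big1// => k /eqP m'E; rewrite x0 ?mulr0// => i.
  apply: leq_ltn_trans (lt_m' i).
  by have -> := congr1 (fun m1 : 'X_{1..n} => m1 i) m'E; rewrite mnmDE leq_addl.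
move=> _ [g g0 <-] m' lt_m'; rewrite mcoeff_pexp_small//.
by move: g0; rewrite maxidealE /= => ->; rewrite expr0n gtn_eqF// if_same.
Qed.

Lemma finite_Bset e : finite_set (@Bset K n p e).
Proof.
apply: (@sub_finite_set _ _ (range (fun x : {ffun 'I_n -> 'I_(p ^ e)} =>
  [multinom (x i : nat) | i < n]))); last exact: finite_image.
rewrite BsetE => m m_lt; exists [ffun i => Ordinal (m_lt i)] => //.
by apply/mnmP => i; rewrite mnmE ffunE.
Qed.

Lemma mcoeffMX_notle g m m' : ~~ (m <= m')%MM -> (g * 'X_[m])@_m' = 0.
Proof.
move=> Nle; rewrite mcoeffM big1// => k /eqP m'E; rewrite mcoeffX.
case: eqP => [mE|_]; rewrite ?mulr0//; case/negP: Nle.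
apply/mnm_lepP => i; rewrite mE.
by have -> := congr1 (fun m1 : 'X_{1..n} => m1 i) m'E; rewrite mnmDE leq_addl.
Qed.

(** The term of index [m'] reaches the monomial [m] only if [m - m'] is an exponent occurring in a
    [p ^ e]-th power; lying in the box, it must be [0]. *)
Lemma mcoeff_is_Gamma e g c m : is_Gamma p e g c -> Bset K p e m ->
  g@_m = (c m)@_0%MM ^+ (p ^ e).
Proof.
move=> gE Bm; have Bfin := finite_Bset e; rewrite {1}gE fsbig_finite//= raddf_sum /=.
have m_lt i : (m i < p ^ e)%N by move: Bm i; rewrite BsetE.
rewrite (bigD1_seq m) ?finmap.fset_uniq ?in_fset_set ?inE//=.
have q_gt0 : (0 < p ^ e)%N by rewrite expn_gt0 prime_gt0// (pcharf_prime charK).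
have := mcoeffMX (c m ^+ (p ^ e)) m 0%MM; rewrite addm0 => ->.
rewrite mcoeff_pexp_small ?eqxx => [|i]; last by rewrite mnm0E.
rewrite big1 ?addr0// => m' m'm.
have [le_m'|/mcoeffMX_notle->//] := boolP (m' <= m)%MM.
rewrite -{1}(submK le_m') addmC mcoeffMX mcoeff_pexp_small; last first.
  by move=> i; rewrite mnmBE (leq_ltn_trans (leq_subr _ _)).
case: eqP => // m0; case/eqP: m'm.
by rewrite -[RHS](submK le_m') m0 add0m.
Qed.

Hypothesis K_perfect : forall a : K, exists b : K, b ^+ p = a.

Lemma perfect_root e (a : K) : exists b, b ^+ (p ^ e) = a.
Proof.
elim: e => [|e [b bE]]; first by exists a; rewrite expr1.
by have [b' b'E] := K_perfect b; exists b'; rewrite expnS exprM b'E.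
Qed.

Lemma is_Gamma_exists e g : exists c, is_Gamma p e g c.
Proof.
have p_gt0 := prime_gt0 (pcharf_prime charK).
have q_gt0 : (0 < p ^ e)%N by rewrite expn_gt0 p_gt0.
have Bfin := finite_Bset e.
rewrite [g]mpolyE; elim/big_ind: _ => [|x y [c xE] [c' yE]|m _].
- exists (fun=> 0); rewrite /is_Gamma fsbig1// => m _.
  by rewrite expr0n gtn_eqF// mul0r.
- exists (fun m => c m + c' m); rewrite /is_Gamma {1}xE {1}yE -fsbig_split//=.
  apply: eq_fsbigr => m _.
  by rewrite exprDn_pchar ?mulrDl// pnat_mpoly_pexp.
- have [b bE] := perfect_root e g@_m.
  (* Divide the exponents by [p ^ e]: the remainders [r] index the basis element, the quotients [s]
     give the root, and perfectness supplies the scalar [b]. *)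
  pose r := [multinom (m i %% p ^ e)%N | i < n].
  pose s := [multinom (m i %/ p ^ e)%N | i < n].
  have Br : Bset K p e r by rewrite BsetE /= => i; rewrite mnmE ltn_pmod.
  exists (fun m' => if m' == r then b *: 'X_[s] else 0).
  rewrite /is_Gamma (fsbigD1 r)//= fsbig1 => [|m' [_ /eqP/negPf->]]; last first.
    by rewrite expr0n gtn_eqF// mul0r.
  rewrite eqxx addr0 exprZn bE mpolyXn -scalerAl -mpolyXD; congr (_ *: 'X_[_]).
  by apply/mnmP => i; rewrite mnmDE mulmnE !mnmE -divn_eq.
Qed.

Lemma Gamma_spec e g : is_Gamma p e g (Gamma p e g).
Proof. exact: xgetPex (is_Gamma_exists e g). Qed.

(** The constant terms of the generators are [p ^ e]-th roots of the coefficients of [g] on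
    [Bset]. *)
Lemma frobenius_root_unit e g :
  (exists2 a, frobenius_root p e g a & ~ maxideal a) <->
  (exists2 m : 'X_{1..n}, forall i, (m i < p ^ e)%N & g@_m != 0).
Proof.
have q_gt0 : (0 < p ^ e)%N by rewrite expn_gt0 prime_gt0// (pcharf_prime charK).
split=> [[a ga aN]|[m m_lt gm]].
  apply: contrapT => h; apply: aN.
  suff : frobenius_root p e g `<=` @maxideal K n by apply.
  apply: smallest_sub; first exact: is_ideal_gen.
  move=> _ [m Bm <-]; rewrite maxidealE /=; apply: contrapT => /eqP c0; apply: h.
  exists m; first by move: Bm; rewrite BsetE.
  by rewrite (mcoeff_is_Gamma (Gamma_spec e g) Bm) expf_eq0 q_gt0.
have Bm : Bset K p e m by rewrite BsetE.
exists (Gamma p e g m); first by apply: sub_gen_smallest; exists m.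
rewrite maxidealE /= => c0; move: gm.
by rewrite (mcoeff_is_Gamma (Gamma_spec e g) Bm) c0 expr0n gtn_eqF// eqxx.
Qed.

(** An equation [1 = a / s] forces [a = s]; conversely [b / s = (b * a) / (s * a)] when [a] lies
    outside [maxideal]. Closure under multiples passes to the union defining [test_ideal] without
    comparing different [e]. *)
Lemma localized_maxideal_eqT (I : set {mpoly K[n]}) :
  (forall a x, I x -> I (a * x)) ->
  localized (@maxideal K n) I = localized (@maxideal K n) setT <->
  (exists2 a, I a & ~ maxideal a).
Proof.
move=> IM; have max0 : @maxideal K n 0 by rewrite maxidealE /= mcoeff0.
have neq0 (s : {mpoly K[n]}) : ~ maxideal s -> s != 0.
  by move=> sN; apply/eqP => s0; apply: sN; rewrite s0.
have maxM (a s : {mpoly K[n]}) : ~ maxideal a -> ~ maxideal s -> ~ maxideal (a * s).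
  rewrite maxidealE /= (rmorphM (mcoeff 0%MM)) /= => /eqP a0 /eqP s0 /eqP.
  by rewrite mulf_eq0 (negPf a0) (negPf s0).
have maxN1 : ~ @maxideal K n 1.
  by rewrite maxidealE /= mcoeff1 eqxx => /eqP; rewrite oner_eq0.
split=> [eqI|[a Ia aN]].
  have : localized (@maxideal K n) setT 1.
    by exists 1 => //; exists 1 => //; rewrite tofrac1 divr1.
  rewrite -eqI => -[a Ia [s sN /eqP]]; rewrite -tofrac1.
  have sF : FracField.tofrac s != 0 by rewrite tofrac_eq0 neq0.
  rewrite (can2_eq (divfK sF) (mulfK sF)) tofrac1 mul1r tofrac_eq => /eqP aE.
  by exists a => //; rewrite aE.
apply/seteqP; split=> x [b _ [s sN <-]]; first by exists b => //; exists s.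
exists (b * a); first exact: IM.
exists (s * a); first exact: maxM.
by rewrite !tofracM -mulf_div divff ?mulr1// tofrac_eq0 neq0.
Qed.

Lemma localized_test_ideal_eqT (R : realType) (lam : R) g :
  localized (@maxideal K n) (test_ideal p lam g) = localized (@maxideal K n) setT <->
  exists2 e, (1 <= e)%N & exists2 m : 'X_{1..n}, forall i, (m i < p ^ e)%N &
    (g ^+ `|Num.ceil ((p ^ e)%:R * lam)|%N)@_m != 0.
Proof.
rewrite localized_maxideal_eqT; last first.
  move=> a x [e e1 xI]; exists e => //.
  by have [_ _] := is_ideal_gen [set Gamma p e (g ^+ `|Num.ceil ((p ^ e)%:R * lam)|%N) m |
    m in Bset K p e]; apply.
split=> [[a [e e1 aI] aN]|[e e1 /frobenius_root_unit[a aI aN]]].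
  by exists e => //; apply/frobenius_root_unit; exists a.
by exists a => //; exists e.
Qed.
End Frobenius.

(** * Coefficients of the powers of the diagonal polynomial *)

Section Diagonal.
Variables (K : fieldType) (n : nat) (d : 'I_n -> nat) (u : 'I_n -> K).
Hypothesis d_gt0 : forall i, (0 < d i)%N.

Definition diagonal_poly : {mpoly K[n]} := \sum_(i < n) u i *: 'X_i ^+ d i.

Definition dilate (k : 'I_n -> nat) : 'X_{1..n} := [multinom (k i * d i)%N | i < n].

Lemma dilateE k i : dilate k i = (k i * d i)%N.
Proof. exact: mnmE. Qed.

Lemma mcoeff_diagonalXS N m : (diagonal_poly ^+ N.+1)@_m =
  \sum_i u i * (diagonal_poly ^+ N * 'X_[U_(i) *+ d i])@_m.
Proof.
rewrite exprSr {2}/diagonal_poly mulr_sumr raddf_sum /=; apply: eq_bigr => i _.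
by rewrite -scalerAr mcoeffZ mpolyXn.
Qed.

Lemma mcoeff_diagonalX_neq0 N m : (diagonal_poly ^+ N)@_m != 0 ->
  exists2 k, (\sum_i k i)%N = N & m = dilate k.
Proof.
elim: N m => [|N IHN] m.
  rewrite expr0 mcoeff1; have [-> _|_] := eqVneq m 0%MM; last by rewrite eqxx.
  exists (fun=> 0%N); first by rewrite big1.
  by apply/mnmP => i; rewrite mnm0E.
rewrite mcoeff_diagonalXS => sum_neq0.
have [i ti] : exists i, u i * (diagonal_poly ^+ N * 'X_[U_(i) *+ d i])@_m != 0.
  apply/existsP; apply: contraNT sum_neq0 => /existsPn t0; rewrite big1// => i _.
  by move/negPn/eqP: (t0 i).
have le_m : (U_(i) *+ d i <= m)%MM.
  by apply: contraNT ti => /mcoeffMX_notle->; rewrite mulr0.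
move: ti; rewrite -{1}(submK le_m) addmC mcoeffMX mulf_eq0 negb_or => /andP[_].
move=> /IHN[k kN mE]; exists (fun j => k j + (j == i))%N; first by rewrite sum_incr kN.
rewrite -(submK le_m) mE; apply/mnmP => j; rewrite mnmDE mulmnE !dilateE mnm1E.
by rewrite mulnDl eq_sym; case: eqP => // ->.
Qed.

(** The multinomial theorem, with the coefficient fixed by an equation in [nat]. In the induction,
    splitting off the [i]-th summand of [f] contributes a share [N! * k i] of the factorial, and the
    [k i] sum to [N.+1]. *)
Lemma mcoeff_diagonalX N k : (\sum_i k i)%N = N ->
  exists C : nat, (diagonal_poly ^+ N)@_(dilate k) = C%:R * \prod_i u i ^+ k i /\
    (C * \prod_i (k i)`! = N`!)%N.
Proof.
elim: N k => [|N IHN] k kN.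
  have k0 i : k i = 0%N by apply/eqP; rewrite -leqn0 -kN (bigD1 i)//= leq_addr.
  exists 1%N; rewrite !big1 => [|i _|i _]; rewrite ?k0//.
  suff -> : dilate k = 0%MM by rewrite mcoeff1 eqxx mulr1.
  by apply/mnmP => i; rewrite mnm0E dilateE k0.
have /choice[C CP] i : exists C : nat,
    u i * (diagonal_poly ^+ N * 'X_[U_(i) *+ d i])@_(dilate k) = C%:R * \prod_i u i ^+ k i /\
    (C * \prod_i (k i)`! = N`! * k i)%N.
  have [ki0|ki_gt0] := posnP (k i).
    (* As [d i > 0] and [k i = 0], no factor ['X_i ^+ d i] can be split off. *)
    exists 0%N; rewrite mul0r mul0n ki0 muln0 mcoeffMX_notle ?mulr0//.
    apply/negP => /mnm_lepP/(_ i); rewrite mulmnE mnm1E eqxx dilateE ki0 mul1n mul0n.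
    by rewrite leqNgt d_gt0.
  pose k' j := (k j - (j == i))%N.
  have kE j : k j = (k' j + (j == i))%N.
    by rewrite subnK//; case: eqP => // ->.
  have k'N : (\sum_i k' i)%N = N.
    by apply: succn_inj; rewrite -kN -(sum_incr _ i); apply: eq_bigr => j _; rewrite -kE.
  have [C [CE Cfact]] := IHN k' k'N; exists C.
  have dE : dilate k = (U_(i) *+ d i + dilate k')%MM.
    apply/mnmP => j; rewrite mnmDE mulmnE !dilateE kE mnm1E mulnDl addnC eq_sym.
    by case: eqP => // ->.
  rewrite dE mcoeffMX CE mulrCA; split.
    congr (_ * _); rewrite [RHS](bigD1 i)//= [in LHS](bigD1 i)//= mulrA.
    congr (_ * _); first by rewrite -exprS kE eqxx addn1.
    by apply: eq_bigr => j /negPf ji; rewrite kE ji addn0.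
  have -> : (\prod_j (k j)`! = (\prod_j (k' j)`!) * k i)%N; last by rewrite mulnA Cfact.
  rewrite [LHS](bigD1 i)//= [in RHS](bigD1 i)//= kE eqxx addn1 factS -mulnA [RHS]mulnC.
  congr (_ * (_ * _))%N.
  by apply: eq_bigr => j /negPf ji; rewrite kE ji addn0.
exists (\sum_i C i)%N; split.
  rewrite mcoeff_diagonalXS natr_sum mulr_suml.
  by apply: eq_bigr => i _; case: (CP i).
rewrite big_distrl /= (eq_bigr (fun i => N`! * k i)%N) => [|i _]; last by case: (CP i).
by rewrite -big_distrr /= kN mulnC.
Qed.

Hypothesis u_neq0 : forall i, u i != 0.

(** The coefficient at [dilate k] is a multinomial coefficient times a nonzero scalar, so
    [multinomial_carry_free] decides whether it survives modulo [p]. *)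
Lemma diagonalX_attained p e N : p \in [pchar K] ->
  (exists2 m : 'X_{1..n}, forall i, (m i < p ^ e)%N & (diagonal_poly ^+ N)@_m != 0) <->
  attained p d e N.
Proof.
move=> charK; have p_pr := pcharf_prime charK.
have coef_neq0 (C : nat) k : (C%:R * \prod_i u i ^+ k i != 0 :> K) = ~~ (p %| C)%N.
  rewrite mulf_eq0 negb_or (dvdn_pcharf charK).
  suff -> : \prod_i u i ^+ k i != 0 by rewrite andbT.
  by apply/prodf_neq0 => i _; rewrite expf_neq0.
split=> [[m m_lt mN]|[k [kP kN k_lt]]].
  have [k kN mE] := mcoeff_diagonalX_neq0 mN.
  have [C [CE Cfact]] := mcoeff_diagonalX kN.
  exists k; split=> //; last by move=> i; move: (m_lt i); rewrite mE dilateE.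
  apply/(multinomial_carry_free (C := C) p_pr); first by rewrite kN.
  by rewrite -(coef_neq0 C k) -CE -mE.
have [C [CE Cfact]] := mcoeff_diagonalX kN.
exists (dilate k); first by move=> i; rewrite dilateE.
rewrite CE coef_neq0; apply/(multinomial_carry_free (C := C) p_pr) => //.
by rewrite kN.
Qed.
End Diagonal.

(** * The real expansion of [1/d] and its integer quotients *)

Section Expansions.
Variables (R : realType) (p : nat).
Hypothesis p_gt1 : (1 < p)%N.
Let p_gt0 : (0 < p)%N := ltnW p_gt1.
Let pR_gt0 e : 0 < p%:R ^+ e :> R.
Proof. by rewrite exprn_gt0// ltr0n. Qed.
Let pR_unit e : p%:R ^+ e != 0 :> R.
Proof. by rewrite lt0r_neq0. Qed.

(** The digits [a 1, ..., a e] read as one integer, which moves comparisons of truncations to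
    [nat]. *)
Definition digit_num (a : nat -> nat) : nat -> nat :=
  fix T e := if e is e'.+1 then (T e' * p + a e)%N else 0%N.

Lemma digit_sumS a e :
  digit_sum R p a e.+1 = digit_sum R p a e + (a e.+1)%:R / p%:R ^+ e.+1.
Proof. by rewrite /digit_sum big_nat_recr. Qed.

Lemma digit_sumE a e : digit_sum R p a e = (digit_num a e)%:R / p%:R ^+ e.
Proof.
elim: e => [|e IHe]; first by rewrite /digit_sum big_geq// mul0r.
rewrite digit_sumS IHe /= natrD natrM mulrDl; congr (_ + _).
by rewrite exprSr invfM mulrACA divff ?mulr1// pnatr_eq0 -lt0n.
Qed.

Lemma digit_sum_nondecreasing a : nondecreasing_seq (digit_sum R p a).
Proof.
apply/nondecreasing_seqP => e; rewrite digit_sumS lerDl.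
by rewrite divr_ge0// ?ler0n// ltW.
Qed.

(** A later nonzero digit makes the lower bound strict. Digits are at most [p - 1], so the
    right-hand bound never increases with [e]. *)
Lemma digit_sum_bounds (x : R) a e : nonterminating_expansion p x a ->
  digit_sum R p a e < x <= digit_sum R p a e + (p%:R ^+ e)^-1.
Proof.
move=> [_ a_lt a_cvg a_inf]; have mono := @digit_sum_nondecreasing a.
have limE : limn (digit_sum R p a) = x by exact/cvg_lim.
have le_x m : digit_sum R p a m <= x.
  by rewrite -limE; apply: nondecreasing_cvgn_le => //; apply/cvg_ex; exists x.
apply/andP; split.
  have [k lt_ek ak] := a_inf e.+1; case: k lt_ek ak => // k le_ek ak.
  apply: lt_le_trans (le_x k.+1); apply: (@le_lt_trans _ _ (digit_sum R p a k)); first exact: mono.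
  by rewrite digit_sumS ltrDl divr_gt0// ltr0n lt0n.
rewrite -limE; apply: limr_le; first by apply/cvg_ex; exists x.
near=> m.
have le_em : (e <= m)%N by near: m; exact: nbhs_infty_ge.
suff tail i : digit_sum R p a (e + i) + (p%:R ^+ (e + i))^-1
    <= digit_sum R p a e + (p%:R ^+ e)^-1.
  have := tail (m - e)%N; rewrite subnKC//; apply: le_trans.
  by rewrite lerDl invr_ge0 ltW.
elim: i => [|i]; first by rewrite addn0.
apply: le_trans; rewrite addnS digit_sumS -addrA lerD2l.
rewrite -[X in _ + X]mul1r -mulrDl ler_pdivrMr// exprSr mulrA mulVf// mul1r.
by rewrite natr1 ler_nat a_lt.
Unshelve. all: by end_near. Qed.

Lemma cvg_pexp_approx (x : R) (v : R ^nat) :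
  (forall e, x - (p%:R ^+ e)^-1 <= v e <= x) -> v @ \oo --> x.
Proof.
move=> vP; apply: (@squeeze_cvgr _ _ _ _ (fun e => x - p%:R^-1 ^+ e) (fun=> x)).
- by near=> e; rewrite exprVn vP.
- rewrite -[X in _ --> X]subr0; apply: cvgB; first exact: cvg_cst.
  by apply: cvg_expr; rewrite ger0_norm ?invr_ge0// invf_lt1 ?ltr1n// ltr0n.
- exact: cvg_cst.
Unshelve. all: by end_near. Qed.

Variable d : nat.
Hypothesis d_gt0 : (0 < d)%N.

Lemma digit_quo_lt e : (digit_quo p d e)%:R / p%:R ^+ e < 1 / d%:R :> R.
Proof.
rewrite ltr_pdivrMr// mulrAC mul1r ltr_pdivlMr ?ltr0n//.
by rewrite -natrM -natrX ltr_nat -leq_digit_quo.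
Qed.

Lemma digit_quo_ge e :
  1 / d%:R - (p%:R ^+ e)^-1 <= (digit_quo p d e)%:R / p%:R ^+ e :> R.
Proof.
rewrite lerBlDr -[X in _ + X]mul1r -mulrDl ler_pdivrMr ?ltr0n// mulrAC.
rewrite ler_pdivlMr// mul1r natr1 -natrM -natrX ler_nat.
by rewrite leqNgt -leq_digit_quo// ltnn.
Qed.

Lemma digit_num_quo a : a 0%N = 0%N ->
  (forall e, digit_num a e = digit_quo p d e) <->
  (forall e, a e = digit_quo p d e %% p)%N.
Proof.
move=> a0; split=> H; last first.
  elim=> [|e IHe]; first by rewrite digit_quo0.
  by rewrite /= IHe H -digit_quo_succ.
case=> [|e]; first by rewrite a0 digit_quo0 mod0n.
by apply: (@addnI (digit_num a e * p)); rewrite [in RHS]H -digit_quo_succ// -H.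
Qed.

Lemma digit_quo_nonterminating :
  nonterminating_expansion p (1 / d%:R : R) (fun e => digit_quo p d e %% p)%N.
Proof.
have a0 : (digit_quo p d 0 %% p = 0)%N by rewrite digit_quo0 mod0n.
have numE := proj2 (@digit_num_quo (fun e => digit_quo p d e %% p)%N a0) (fun=> erefl).
split=> //; first by move=> k; rewrite ltn_mod.
  apply: cvg_pexp_approx => e; rewrite digit_sumE numE digit_quo_ge/=.
  exact/ltW/digit_quo_lt.
move=> N; apply: contrapT => h.
have a_eq0 k : (N <= k)%N -> (digit_quo p d k %% p = 0)%N.
  by move=> le_Nk; apply: contrapT => /eqP ak; apply: h; exists k.
have quoE m : (digit_quo p d (N + m) = digit_quo p d N * p ^ m)%N.
  elim: m => [|m IHm]; first by rewrite addn0 muln1.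
  rewrite addnS digit_quo_succ// a_eq0 ?addn0 ?IHm ?expnSr ?mulnA//.
  by rewrite -addnS leq_addr.
(* The gap [p ^ N - digit_quo p d N * d] is at least [1]. With zero digits after [N] it is scaled by
   [p ^ d > d], so the quotient at level [N + d] would not be maximal. *)
have := leq_digit_quo (N + d) (digit_quo p d (N + d)).+1 p_gt0 d_gt0.
rewrite ltnn => /esym/negbT; rewrite -leqNgt quoE mulSn mulnAC expnD.
have : (digit_quo p d N * d < p ^ N)%N by rewrite -leq_digit_quo.
rewrite -(leq_pmul2r (_ : 0 < p ^ d)%N) ?expn_gt0 ?p_gt0// mulSn => le1 le2.
have := leq_trans le1 le2; rewrite leq_add2r leqNgt.
by rewrite ltn_expl.
Qed.

(** By [digit_sum_bounds], any nonterminating expansion has as [digit_num a e] the largest integer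
    strictly below [p ^ e / d], so the choice made by [xget] is unique. *)
Lemma digitE : digit p (1 / d%:R : R) = (fun e => digit_quo p d e %% p)%N.
Proof.
apply: xget_unique; first exact: digit_quo_nonterminating.
move=> a aP; apply/funext; have [a0 _ _ _] := aP; apply/digit_num_quo => // e.
have /andP[] := digit_sum_bounds e aP; rewrite digit_sumE => lt1 le2.
apply/eqP; rewrite eqn_leq leq_digit_quo//; apply/andP; split.
  move: lt1; rewrite ltr_pdivrMr// mulrAC mul1r ltr_pdivlMr ?ltr0n//.
  by rewrite -natrM -natrX ltr_nat.
rewrite -ltnS ltnNge leq_digit_quo// -leqNgt.
move: le2; rewrite -[X in _ + X]mul1r -mulrDl ler_pdivrMr ?ltr0n// mulrAC.
by rewrite ler_pdivlMr// mul1r natr1 -natrM -natrX ler_nat.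
Qed.

Lemma truncationE e :
  truncation p (1 / d%:R : R) e = (digit_quo p d e)%:R / p%:R ^+ e.
Proof.
rewrite /truncation digitE digit_sumE.
by rewrite (proj2 (@digit_num_quo _ _) (fun=> erefl))// digit_quo0 mod0n.
Qed.
End Expansions.

(** * Computing the supremum and the threshold *)

Lemma ereal_sup_pexp (R : realType) (p : nat) (S : set R) (x c : R) : (1 < p)%N ->
  (forall y, S y -> y <= x) ->
  (forall m, exists2 y, S y & x - c / p%:R ^+ m <= y) ->
  ereal_sup [set y%:E | y in S] = x%:E.
Proof.
move=> p_gt1 ubS apx; apply/eqP; rewrite eq_le; apply/andP; split.
  by apply: ge_ereal_sup => _ [y Sy <-]; rewrite lee_fin ubS.
apply/lee_addgt0Pr => e e_gt0.
(* This index exceeds [c / e], and [p ^ m > m]. *)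
have [y Sy le_y] := apx (Num.trunc (c / e)).+1.
have : (y%:E <= ereal_sup [set y%:E | y in S])%E by apply: ereal_sup_ubound; exists y.
move=> /(leeD2r e%:E); apply: le_trans; rewrite -EFinD lee_fin -lerBlDr.
apply: le_trans le_y; rewrite lerD2l lerN2 ler_pdivrMr; last first.
  by rewrite exprn_gt0// ltr0n ltnW.
rewrite mulrC -ler_pdivrMr// ltW// (lt_le_trans (truncnS_gt _))//.
by rewrite -natrX ler_nat ltnW// ltn_expl.
Qed.

Section FPureThreshold.
Variables (R : realType) (p n : nat) (d : 'I_n -> nat).
Hypotheses (p_gt1 : (1 < p)%N) (d_gt0 : forall i, (0 < d i)%N).
Let p_gt0 : (0 < p)%N := ltnW p_gt1.
Let pR_gt0 e : 0 < p%:R ^+ e :> R.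
Proof. by rewrite exprn_gt0// ltr0n. Qed.

(** Its supremum is the threshold, by [fpt_diagonal]. *)
Definition attained_exponents : set R :=
  [set lam | 0 <= lam /\
    exists2 e, (1 <= e)%N & attained p d e `|Num.ceil ((p ^ e)%:R * lam)|%N].

Lemma attained_exponents_ratio e N : (1 <= e)%N -> attained p d e N ->
  attained_exponents (N%:R / p%:R ^+ e).
Proof.
move=> e_gt0 attN; split; first by rewrite divr_ge0// ltW.
exists e => //; rewrite natrX mulrC divfK ?lt0r_neq0//.
by rewrite -[N%:R]/((N%:Z)%:~R) intrKceil.
Qed.

Lemma attained_exponents_le lam : attained_exponents lam ->
  exists e N, [/\ (1 <= e)%N, attained p d e N & lam <= N%:R / p%:R ^+ e].
Proof.
move=> [lam_ge0 [e e_gt0 attN]]; exists e, `|Num.ceil ((p ^ e)%:R * lam)|%N; split=> //.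
have ceil_ge0 : 0 <= Num.ceil ((p ^ e)%:R * lam) by rewrite ceil_ge0 (lt_le_trans (ltrN10 _))// mulr_ge0.
by rewrite natr_absz ger0_norm// ler_pdivlMr// mulrC -natrX ceil_ge.
Qed.

Lemma attained_ratio_le e N : attained p d e N ->
  N%:R / p%:R ^+ e <= \sum_(i < n) 1 / (d i)%:R :> R.
Proof.
case=> k [_ <- k_lt]; rewrite natr_sum mulr_suml; apply: ler_sum => i _.
rewrite ler_pdivrMr// mulrAC mul1r ler_pdivlMr ?ltr0n//.
by rewrite -natrM -natrX ler_nat ltnW.
Qed.

Lemma sup_attained_no_carry : (forall e, digits_carry_free p d e) ->
  ereal_sup [set lam%:E | lam in attained_exponents] = (\sum_(i < n) 1 / (d i)%:R)%:E.
Proof.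
(* The constant is [n]: each of the [n] truncations loses at most one unit of its last place. *)
move=> free; apply: (@ereal_sup_pexp _ p _ _ n%:R) => // [lam /attained_exponents_le|m].
  by move=> [e [N [_ attN /le_trans]]]; apply; exact: attained_ratio_le.
(* Level [m.+1], because the test ideal only uses [e >= 1]. *)
pose N := (\sum_i digit_quo p (d i) m.+1)%N.
exists (N%:R / p%:R ^+ m.+1).
  by apply: attained_exponents_ratio => //; apply: attained_digit_quo.
have le_m : n%:R / p%:R ^+ m.+1 <= n%:R / p%:R ^+ m :> R.
  by rewrite ler_wpM2l// lef_pV2 ?posrE// ler_weXn2l ?ler1n.
apply: (@le_trans _ _ (\sum_(i < n) 1 / (d i)%:R - n%:R / p%:R ^+ m.+1)).
  by rewrite lerD2l lerN2.
have -> : n%:R / p%:R ^+ m.+1 = \sum_(i < n) (p%:R ^+ m.+1)^-1 :> R.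
  by rewrite sumr_const card_ord mulr_natl.
rewrite -sumrB /N natr_sum mulr_suml; apply: ler_sum => i _.
exact: digit_quo_ge.
Qed.

Lemma sup_attained_carry l :
  (forall e, (e <= l)%N -> digits_carry_free p d e) -> ~ digits_carry_free p d l.+1 ->
  ereal_sup [set lam%:E | lam in attained_exponents] =
    (\sum_(i < n) (digit_quo p (d i) l)%:R / p%:R ^+ l + 1 / p%:R ^+ l)%:E.
Proof.
move=> free carry; rewrite -mulr_suml -mulrDl -natr_sum natr1.
set A := (\sum_i digit_quo p (d i) l)%N.
apply: (@ereal_sup_pexp _ p _ _ 1) => // [lam /attained_exponents_le|m].
  move=> [e [N [_ /(attained_bound p_gt0 d_gt0 l) le_N /le_trans]]]; apply.
  rewrite ler_pdivrMr// mulrAC ler_pdivlMr//.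
  by rewrite -!natrX -!natrM ler_nat.
have [N attN NE] := attained_after_carry p_gt0 d_gt0 m free carry.
exists (N%:R / p%:R ^+ (l.+1 + m)); first exact: attained_exponents_ratio.
(* The witness misses the bound by exactly [1 / p ^ (l.+1 + m)]. *)
have -> : A.+1%:R / p%:R ^+ l = N.+1%:R / p%:R ^+ (l.+1 + m) :> R.
  rewrite NE -/A natrM natrX addSnnS exprD mulrC [X in _ = X / _]mulrC -mulf_div.
  by rewrite divff ?mulr1 1?mulrC ?lt0r_neq0.
rewrite -natr1 mulrDl -addrA gerDl subr_le0 ler_wpM2l//.
by rewrite lef_pV2 ?posrE// ler_weXn2l ?ler1n ?leq_addl.
Qed.

Let alpha : 'I_n -> R := fun i => 1 / (d i)%:R.

Lemma add_without_carryingE e : add_without_carrying p alpha e <-> digits_carry_free p d e.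
Proof.
rewrite /add_without_carrying /digits_carry_free.
by rewrite (eq_bigr (fun i => digit_quo p (d i) e %% p)%N) // => i _; rewrite /alpha digitE.
Qed.

Lemma carry_sup_pinfty : carry_sup p alpha = +oo%E -> forall e, digits_carry_free p d e.
Proof.
move=> supE e; apply: contrapT => carry.
suff : (carry_sup p alpha <= e%:R%:E)%E by rewrite supE leye_eq.
apply: ge_ereal_sup => _ [N freeN <-]; rewrite lee_fin ler_nat leqNgt.
by apply/negP => lt_eN; apply/carry/add_without_carryingE/freeN/ltnW.
Qed.

Lemma carry_sup_fin : (carry_sup p alpha < +oo)%E -> exists l : nat,
  [/\ carry_sup p alpha = l%:R%:E, (forall e, (e <= l)%N -> digits_carry_free p d e)
    & ~ digits_carry_free p d l.+1].
Proof.
move=> sup_fin.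
have ex_carry : exists e, ~~ (\sum_i digit_quo p (d i) e %% p <= p.-1)%N.
  apply: contrapT => /forallNP free.
  have le_sup N : (N%:R%:E <= carry_sup p alpha)%E.
    apply: ereal_sup_ubound; exists N => // e _; apply/add_without_carryingE.
    by apply: contrapT => /negP; exact: free.
  case: (carry_sup p alpha) sup_fin le_sup => [r _|//|_ /(_ 0%N)//].
  by move=> /(_ (Num.trunc r).+1); rewrite lee_fin leNgt truncnS_gt.
(* The first level with a carry is positive, since the digits at level [0] vanish; [l] is its
   predecessor. *)
case: (ex_minnP ex_carry) => -[|l] carry minl.
  by move: carry; rewrite big1 // => i _; rewrite digit_quo0 mod0n.
have free e : (e <= l)%N -> digits_carry_free p d e.
  by move=> le_el; apply: contraT => /minl; rewrite ltnNge le_el.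
exists l; split=> //; last exact/negP.
apply/eqP; rewrite eq_le; apply/andP; split; last first.
  by apply: ereal_sup_ubound; exists l => // e le_el; apply/add_without_carryingE/free.
apply: ge_ereal_sup => _ [N freeN <-]; rewrite lee_fin ler_nat leqNgt.
apply/negP => lt_lN; move/negP: carry; apply.
exact/add_without_carryingE/freeN.
Qed.
End FPureThreshold.

Lemma fpt_diagonal (R : realType) (p : nat) (K : fieldType) (n : nat)
    (d : 'I_n -> nat) (u : 'I_n -> K) :
  p \in [pchar K] -> (forall a : K, exists b : K, b ^+ p = a) ->
  (forall i, (0 < d i)%N) -> (forall i, u i != 0) ->
  fpt p R (diagonal_poly d u) = ereal_sup [set lam%:E | lam in @attained_exponents R p n d].
Proof.
move=> charK K_perfect d_gt0 u_neq0; rewrite /fpt; congr (ereal_sup (image _ _)).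
apply/seteqP; split=> lam /= [lam_ge0].
  move=> /(localized_test_ideal_eqT charK K_perfect)[e e_gt0 mP].
  by split=> //; exists e => //; apply/(diagonalX_attained d_gt0 u_neq0 _ _ charK).
move=> [e e_gt0 attN]; split=> //; apply/(localized_test_ideal_eqT charK K_perfect).
by exists e => //; apply/(diagonalX_attained d_gt0 u_neq0 _ _ charK).
Qed.

Theorem theorem3p1 (R : realType) (p : nat) (K : fieldType)
  (p_prime : prime p) (charK : p \in [pchar K])
  (K_perfect : forall a : K, exists b : K, b ^+ p = a)
  (n : nat) (n_ge1 : (1 <= n)%N)
  (d : 'I_n -> nat) (d_gt0 : forall i, (0 < d i)%N)
  (u : 'I_n -> K) (u_neq0 : forall i, u i != 0) :
  let f : {mpoly K[n]} := \sum_(i < n) u i *: 'X_i ^+ d i in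
  let alpha : 'I_n -> R := fun i => 1 / (d i)%:R in
  let L : \bar R := carry_sup p alpha in
  (L = +oo%E -> fpt p R f = (\sum_(i < n) alpha i)%:E) /\
  ((L < +oo)%E -> exists2 l : nat, L = l%:R%:E
    & fpt p R f =
      (\sum_(i < n) truncation p (alpha i) l + 1 / p%:R ^+ l)%:E).
Proof.
move=> f alpha L; have p_gt1 := prime_gt1 p_prime.
have fE : fpt p R f = ereal_sup [set lam%:E | lam in @attained_exponents R p n d].
  exact: fpt_diagonal.
split=> [Linf|/(carry_sup_fin p_gt1 d_gt0)[l [LE free carry]]].
  by rewrite fE (sup_attained_no_carry R p_gt1 d_gt0 (carry_sup_pinfty p_gt1 d_gt0 Linf)).
exists l => //; rewrite fE (sup_attained_carry R p_gt1 d_gt0 free carry).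
by congr ((_ + _)%:E); apply: eq_bigr => i _; rewrite truncationE.
Qed.
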